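(* Let $\underline{T}:\mathbb{R}^{\mathcal{X}}\to\mathbb{R}^{\mathcal{X}}$ be a map that satisfies the coherence conditions C1, C2, C3 and the reachability condition R1 (listed in the context), and let $\mathcal{T}$ be its dual representation. Let $T_1\in\mathcal{T}$ be any extreme point of $\mathcal{T}$ and, for all $n\in\mathbb{N}$, let $h_n$ be the unique solution in $\mathbb{R}^{\mathcal{X}}$ of the linear system $h_n=\mathbb{I}_{A^c}+\mathbb{I}_{A^c}\cdot T_nh_n$, and let $T_{n+1}$ be an extreme point of $\mathcal{T}$ such that $\underline{T}h_n=T_{n+1}h_n$. Then the sequence $\{h_n\}_{n\in\mathbb{N}}$ is non-increasing, and its limit $h_*=\lim_{n\to+\infty}h_n$ is the unique solution in $\mathbb{R}^{\mathcal{X}}$ of the equation $\underline{h} = \mathbb{I}_{A^c} + \mathbb{I}_{A^c}\cdot\underline{T}\,\underline{h}$.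
   Context: $\mathcal{X}$ is a non-empty finite set, $A$ is a non-empty strict subset of $\mathcal{X}$, and $A^c = \mathcal{X}\setminus A$. $\mathbb{R}^{\mathcal{X}}$ is the set of all maps from $\mathcal{X}$ to $\mathbb{R}$; inequalities between such maps (and monotonicity of sequences) are pointwise, a constant is identified with the corresponding constant map, and $\cdot$ denotes pointwise multiplication. For $B\subseteq\mathcal{X}$, $\mathbb{I}_B\in\mathbb{R}^{\mathcal{X}}$ is the indicator of $B$. $\mathbb{N}$ does not contain $0$, and $M^n$ denotes the $n$-fold composition of a map $M$ with itself. Coherence conditions for a (possibly non-linear) map $\underline{T}:\mathbb{R}^{\mathcal{X}}\to\mathbb{R}^{\mathcal{X}}$: C1: $\underline{T}(\alpha f)=\alpha\underline{T}f$ for all $f\in\mathbb{R}^{\mathcal{X}}$ and all real $\alpha\geq 0$; C2: $\underline{T}f+\underline{T}g\leq\underline{T}(f+g)$ for all $f,g\in\mathbb{R}^{\mathcal{X}}$; C3: $\min_{x\in\mathcal{X}}f(x)\leq\underline{T}f$ for all $f\in\mathbb{R}^{\mathcal{X}}$. Reachability condition R1: for all $x\in A^c$ there is some $n_x\in\mathbb{N}$ such that $[\underline{T}^{n_x}\mathbb{I}_A](x)>0$. Separately specified rows: for a map $T:\mathbb{R}^{\mathcal{X}}\to\mathbb{R}^{\mathcal{X}}$ and $x\in\mathcal{X}$, let $T_x:\mathbb{R}^{\mathcal{X}}\to\mathbb{R}$, $f\mapsto[Tf](x)$. A set $\mathcal{T}$ of maps from $\mathbb{R}^{\mathcal{X}}$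 to $\mathbb{R}^{\mathcal{X}}$ has separately specified rows if $\mathcal{T}=\{T:\mathbb{R}^{\mathcal{X}}\to\mathbb{R}^{\mathcal{X}}\mid T_x\in\mathcal{T}_x\text{ for all }x\in\mathcal{X}\}$, where $\mathcal{T}_x=\{T_x\mid T\in\mathcal{T}\}$. Dual representation: for $\underline{T}$ satisfying C1, C2, C3, its dual representation $\mathcal{T}$ is the unique non-empty, closed and convex set with separately specified rows such that each $T\in\mathcal{T}$ is a linear map from $\mathbb{R}^{\mathcal{X}}$ to $\mathbb{R}^{\mathcal{X}}$ satisfying C1, C2, C3 (i.e. a row-stochastic $|\mathcal{X}|\times|\mathcal{X}|$ matrix), and such that $\underline{T}f=\inf_{T\in\mathcal{T}}Tf$ (pointwise infimum) for all $f\in\mathbb{R}^{\mathcal{X}}$. It is known that $\mathcal{T}$ has extreme points and that for every $f\in\mathbb{R}^{\mathcal{X}}$ there is an extreme point $T$ of $\mathcal{T}$ with $\underline{T}f=Tf$. Under R1, for each $T\in\mathcal{T}$ the system $h=\mathbb{I}_{A^c}+\mathbb{I}_{A^c}\cdot Th$ has a unique solution in $\mathbb{R}^{\mathcal{X}}$. *)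

(* Defs.v *)
From mathcomp Require Export all_boot all_order all_algebra.
From mathcomp Require Export all_classical all_reals all_analysis.
Export numFieldNormedType.Exports.
Export Order.TTheory GRing.Theory Num.Theory.

Set Implicit Arguments.
Unset Strict Implicit.
Unset Printing Implicit Defensive.

Local Open Scope classical_set_scope.
Local Open Scope ring_scope.

(* An arbitrary, possibly non-linear, map from R^X to R^X; both R^X and the
   type of operators carry the pointwise lmodType structure over R. *)
Definition operator (R : realType) (X : finType) := (X -> R) -> (X -> R).

Section Operators.
Variables (R : realType) (X : finType).
Implicit Types (T : operator R X) (Ts : set (operator R X)) (A : set X).

Definition coherent1 T := forall (f : X -> R) (a : R),
  0 <= a -> T (a *: f) = a *: T f.

Definition coherent2 T := forall (f g : X -> R) (x : X),
  T f x + T g x <= T (f + g) x.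

(* The seed f x of the iterated minimum is itself one of the values of f, so
   the left-hand side is exactly the minimum of f over X. *)
Definition coherent3 T := forall (f : X -> R) (x : X),
  \big[Num.min/f x]_(y : X) f y <= T f x.

Definition coherent T := [/\ coherent1 T, coherent2 T & coherent3 T].

Definition reachable A T := forall x : X, ~ A x ->
  exists n : nat, (0 < n)%N /\ 0 < iter n T \1_A x.

Definition row_of (x : X) T : (X -> R) -> R := fun f => T f x.

Definition separately_specified_rows Ts :=
  Ts = [set T | forall x : X, [set row_of x T' | T' in Ts] (row_of x T)].

(* Closedness is with respect to pointwise convergence of operators.  The
   linear operators form a pointwise closed set, on which this topology is the
   usual one on |X| x |X| matrices, so on sets of linear operators this is
   closedness as a set of matrices. *)
Definition closed_operators Ts :=
  closed (Ts : set {ptws (X -> R) -> {ptws X -> R}}).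

(* The infimum is that of a non-empty set of reals, bounded below because the
   members of Ts satisfy coherent3. *)
Definition dual_representation T Ts :=
  [/\ Ts !=set0,
      closed_operators Ts,
      convex_set Ts,
      separately_specified_rows Ts &
      (forall T', Ts T' -> linear T' /\ coherent T') /\
      (forall (f : X -> R) (x : X), T f x = inf [set T' f x | T' in Ts])].

Definition extreme_point Ts T :=
  Ts T /\ forall (T1 T2 : operator R X) (t : R),
    Ts T1 -> Ts T2 -> 0 < t < 1 -> T = t *: T1 + (1 - t) *: T2 ->
    T1 = T /\ T2 = T.

Definition hitting_eq A T (h : X -> R) :=
  h = \1_(~` A) + \1_(~` A) \* T h.

End Operators.

(* Main.v *)
Require Import Defs.
From mathcomp Require Import all_boot all_order all_algebra.
From mathcomp Require Import all_classical all_reals all_analysis.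
From mathcomp Require Import lra.

(** The engine is a minimum principle for a coherent [T] from which [A] is
    reachable: if [d >= 0] on [A] and [d >= T d] off [A], then [d >= 0].  If the
    minimum [m] of [d] were negative, induction on [n] would give
    [d - m >= - m * T^n 1_A] for all [n], which reachability contradicts at a
    minimiser.  Superadditivity makes the difference of two (super)solutions of
    the hitting equation satisfy the hypotheses; this yields uniqueness,
    [h n.+1 <= h n] and [0 <= h n].  The pointwise limit is squeezed by
    [1 + Tlow hlim <= 1 + Tlow (h n.+1) <= h n.+1 <= 1 + Tlow (h n)] off [A]. *)

Local Open Scope classical_set_scope.
Local Open Scope ring_scope.

Section CoherentOperators.
Set Implicit Arguments.
Unset Strict Implicit.

Variables (R : realType) (X : finType).
Implicit Types (T : operator R X) (A : set X) (f g h : X -> R).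

Lemma coherent_ge T f (c : R) x :
  coherent T -> (forall y, c <= f y) -> c <= T f x.
Proof.
move=> [_ _ T3] cf; apply: le_trans (T3 f x).
by elim/big_ind: _ => // u v cu cv; rewrite le_min cu cv.
Qed.

Lemma coherent_subr_ge T f g x :
  coherent T -> T (f - g) x <= T f x - T g x.
Proof. by move=> [_ T2 _]; rewrite lerBrDr -{2}(subrK g f). Qed.

(** Superadditivity gives [T (g - f) <= T g - T f], and [g - f >= - c] bounds the left side below by
    [- c]. *)
Lemma coherent_le_addr T f g (c : R) x : coherent T ->
  (forall y, f y <= g y + c) -> T f x <= T g x + c.
Proof.
move=> cohT fg; have := coherent_subr_ge g f x cohT.
have : - c <= T (g - f) x.
  by apply: coherent_ge => // y; rewrite !fctE; have := fg y; lra.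
by lra.
Qed.

Lemma coherent_le T f g x : coherent T ->
  (forall y, f y <= g y) -> T f x <= T g x.
Proof.
move=> cohT fg; rewrite -[leRHS]addr0.
by apply: coherent_le_addr => // y; rewrite addr0.
Qed.

Lemma iter_coherent_le1 T A n x : coherent T -> iter n T \1_A x <= 1.
Proof.
move=> cohT; elim: n x => [|n IHn] x /=; first by rewrite indicE; case: (_ \in _).
have [T1 _ _] := cohT.
(* Homogeneity with factor 0; the bound 1 then comes from comparing the iterate with [0 + 1]. *)
have T0 : T 0 x = 0 by have := T1 0 0 (lexx 0); rewrite !scale0r => ->.
rewrite -[leRHS]add0r -T0; apply: coherent_le_addr => // y.
by rewrite add0r.
Qed.

(** Carries reachability from [Tlow] to the members of its dual representation, which dominate it;
    monotonicity of the smaller operator drives the induction. *)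
Lemma reachable_le T T' A : coherent T ->
  (forall f x, T f x <= T' f x) -> reachable A T -> reachable A T'.
Proof.
move=> cohT TT' reachT x /reachT[n [n0 Tn]]; exists n; split=> //.
apply: lt_le_trans Tn _; elim: n x {n0} => [|n IHn] x //=.
by apply: le_trans (TT' _ _); exact: coherent_le.
Qed.

Lemma minimum_principle T A (d : X -> R) : coherent T -> reachable A T ->
  (forall x, A x -> 0 <= d x) -> (forall x, ~ A x -> T d x <= d x) ->
  forall x, 0 <= d x.
Proof.
move=> cohT reachT dA dAc x0.
have [x _ dmin] := @Order.TotalTheory.arg_minP _ _ X x0 xpredT d isT.
apply: le_trans (dmin x0 isT); rewrite leNgt; apply/negP => dx.
have /reachT[n [_ Tn]] : ~ A x by move=> /dA; rewrite leNgt dx.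
pose m := d x.
have key k y : - m * iter k T \1_A y <= d y - m.
  elim: k y => [|k IHk] y.
    rewrite /= indicE; case: (boolP (y \in A)) => [|_] /=.
      by move=> /set_mem/dA; rewrite mulr1; lra.
    by rewrite mulr0 subr_ge0 dmin.
  have [Ay|Acy] := pselect (A y).
    (* On [A] the iterate is at most 1 and [- m > 0], so the left side is at most
       [- m <= d y - m]. *)
    have := iter_coherent_le1 A k.+1 y cohT; have := dA y Ay.
    by rewrite -/m in dx *; nra.
  have [T1 _ _] := cohT.
  have := dAc y Acy; have m0 : 0 <= - m by rewrite oppr_ge0 ltW.
  (* The factor [- m] may enter [T] because it is nonnegative. *)
  have -> : - m * iter k.+1 T \1_A y = T (- m *: iter k T \1_A) y by rewrite T1.
  have : T (- m *: iter k T \1_A) y <= T d y - m.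
    by apply: coherent_le_addr => // z; exact: IHk.
  by lra.
have := key n x; rewrite /m subrr leNgt => /negP; apply.
by rewrite mulr_gt0// oppr_gt0.
Qed.

Lemma hitting_eqP A T h : hitting_eq A T h <->
  (forall x, A x -> h x = 0) /\ (forall x, ~ A x -> h x = 1 + T h x).
Proof.
have indA x : A x -> \1_(~` A) x = 0 :> R.
  by move=> Ax; rewrite indicE memNset.
have indAc x : ~ A x -> \1_(~` A) x = 1 :> R.
  by move=> Ax; rewrite indicE mem_set.
split=> [hE|[hA hAc]].
  split=> x Ax; rewrite {1}hE !fctE /=; first by rewrite indA// mul0r addr0.
  by rewrite indAc// mul1r.
apply/funext => x; rewrite fctE /=; have [Ax|Ax] := pselect (A x).
  by rewrite hA// indA// mul0r addr0.
by rewrite hAc// indAc// mul1r.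
Qed.

(** Off [A] the constants 1 cancel: [T (h - f) <= T h - T f <= h - f], so the minimum principle
    applies to [h - f]. *)
Lemma hitting_eq_le T A f h : coherent T -> reachable A T ->
  hitting_eq A T f ->
  (forall x, A x -> 0 <= h x) -> (forall x, ~ A x -> 1 + T h x <= h x) ->
  forall x, f x <= h x.
Proof.
move=> cohT reachT /hitting_eqP[fA fAc] hA hAc x; rewrite -subr_ge0.
apply: (minimum_principle (d := h - f) cohT reachT) => {}x Ax.
  by rewrite !fctE fA// subr0 hA.
have := coherent_subr_ge h f x cohT; have := hAc x Ax.
by rewrite !fctE (fAc x Ax); lra.
Qed.

Lemma hitting_eq_unique T A f g : coherent T -> reachable A T ->
  hitting_eq A T f -> hitting_eq A T g -> f = g.
Proof.
move=> cohT reachT fE gE.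
have le u v : hitting_eq A T u -> hitting_eq A T v -> forall x, u x <= v x.
  move=> uE /hitting_eqP[vA vAc]; apply: (hitting_eq_le cohT reachT uE) => x Ax.
    by rewrite vA.
  by rewrite -vAc.
by apply/funext => x; apply/eqP; rewrite eq_le !le.
Qed.

Lemma hitting_eq_ge0 T A f : coherent T -> reachable A T ->
  hitting_eq A T f -> forall x, 0 <= f x.
Proof.
move=> cohT reachT /hitting_eqP[fA fAc].
apply: (minimum_principle cohT reachT) => x Ax; first by rewrite fA.
by rewrite [leRHS]fAc// lerDr.
Qed.

Lemma dual_representation_le T (Ts : set (operator R X)) T' f x :
  dual_representation T Ts -> Ts T' -> T f x <= T' f x.
Proof.
move=> [_ _ _ _ [cohTs TE]] TsT'; rewrite TE; apply: ge_inf; last by exists T'.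
(* The infimum is of a set bounded below: [coherent3] gives the minimum of [f] as a common lower
   bound. *)
exists (\big[Num.min/f x]_(y : X) f y) => _ [S TsS <-].
by have [_ [_ _]] := cohTs S TsS; apply.
Qed.

End CoherentOperators.

Theorem proposition7 (R : realType) (X : finType) (A : set X)
    (A_neq0 : A !=set0) (A_strict : A `<` [set: X])
    (Tlow : operator R X) (Tlow_coherent : coherent Tlow)
    (Tlow_reach : reachable A Tlow)
    (Ts : set (operator R X)) (Ts_dual : dual_representation Tlow Ts)
    (T : nat -> operator R X) (h : nat -> X -> R)
    (T1_extreme : extreme_point Ts (T 1%N))
    (h_sol : forall n : nat, (0 < n)%N -> hitting_eq A (T n) (h n))
    (TS_extreme : forall n : nat, (0 < n)%N -> extreme_point Ts (T n.+1))
    (TS_attains : forall n : nat, (0 < n)%N -> Tlow (h n) = T n.+1 (h n)) :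
  (forall n : nat, (0 < n)%N -> forall x : X, h n.+1 x <= h n x) /\
  (exists hlim : X -> R,
    [/\ forall x : X, h n x @[n --> \oo] --> hlim x,
        hitting_eq A Tlow hlim &
        forall g : X -> R, hitting_eq A Tlow g -> g = hlim]).
Proof.
have TsT n : (0 < n)%N -> Ts (T n).
  by case: n => [//|[_|n _]]; [case: T1_extreme|case: (TS_extreme n.+1 isT)].
have cohT n : (0 < n)%N -> coherent (T n).
  by case: Ts_dual => _ _ _ _ [+ _] => /[swap] /TsT /[swap] /[apply] -[].
have leT n f x : (0 < n)%N -> Tlow f x <= T n f x.
  by move=> /TsT; exact: dual_representation_le.
have reachT n : (0 < n)%N -> reachable A (T n).
  by move=> n0; apply: reachable_le Tlow_reach => // f x; exact: leT.
have hA n x : (0 < n)%N -> A x -> h n x = 0.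
  by move=> /h_sol/hitting_eqP[+ _]; exact.
have hAc n x : (0 < n)%N -> ~ A x -> h n x = 1 + T n (h n) x.
  by move=> /h_sol/hitting_eqP[_]; exact.
have h_step n x : (0 < n)%N -> h n.+1 x <= h n x.
  move=> n0; apply: (hitting_eq_le (cohT n.+1 isT) (reachT n.+1 isT)).
  - exact: h_sol.
  - by move=> y Ay; rewrite hA.
  (* [h n] is a supersolution for [T n.+1], as [T n.+1 (h n) = Tlow (h n) <= T n (h n)]. *)
  - by move=> y Ay; rewrite -TS_attains// [leRHS]hAc// lerD2l leT.
split=> // [n n0 x|]; first exact: h_step.
(* The shift skips [h 0], about which nothing is assumed. *)
pose u x : R^nat := fun n => h n.+1 x.
have u_noninc x : nonincreasing_seq (u x).
  by apply/nonincreasing_seqP => n; exact: h_step.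
have u_cvg x : cvgn (u x).
  apply: nonincreasing_is_cvgn => //; exists 0 => _ [n _ <-].
  exact: (hitting_eq_ge0 (cohT n.+1 isT) (reachT n.+1 isT) (h_sol n.+1 isT)).
pose hlim x := limn (u x).
have hlim_le x n : hlim x <= h n.+1 x by exact: nonincreasing_cvgn_ge.
have hlim_sol : hitting_eq A Tlow hlim.
  apply/hitting_eqP; split=> x Ax.
    rewrite /hlim (_ : u x = cst 0); first exact: lim_cst.
    by apply/funext => n; exact: hA.
  apply/eqP; rewrite eq_le; apply/andP; split; last first.
    apply: limr_ge; first exact: u_cvg.
    apply: nearW => n; rewrite /u hAc// lerD2l; apply: le_trans (leT n.+1 _ _ isT).
    by apply: coherent_le => // y; exact: hlim_le.
  apply/ler_addgt0Pr => e e0.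
  (* Finiteness of [X] makes the pointwise convergence uniform, so one index serves all states. *)
  have [N hN] : exists n, forall y, h n.+1 y <= hlim y + e.
    have : \forall n \near \oo, forall y, u y n <= hlim y + e.
      apply: filter_forall => y; have /cvgrPdist_le /(_ e e0) := u_cvg y.
      by apply: filterS => n; rewrite ler_norml -/(hlim y) => /andP[? _]; lra.
    by case=> N _ uN; exists N; exact: (uN N (leqnn N)).
  (* As [Tlow (h N.+1)] is [T N.+2 (h N.+1)], monotonicity of [T N.+2] and [h N.+2 <= h N.+1]
     suffice. *)
  have : h N.+2 x <= 1 + Tlow (h N.+1) x.
    rewrite hAc// TS_attains// lerD2l; apply: coherent_le; first exact: cohT.
    by move=> y; exact: h_step.
  have := coherent_le_addr x Tlow_coherent hN.
  have := hlim_le x N.+1.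
  by lra.
exists hlim; split=> // [x|g g_sol]; last exact: (hitting_eq_unique Tlow_coherent Tlow_reach).
by rewrite -(cvg_shiftS (h^~ x)); exact: u_cvg.
Qed.
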